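(* Let $G_p$ and $G_c$ be IF-OFP systems with passivity indices $(\nu_p,\rho_p)$ and $(\nu_c,\rho_c)$ respectively, interconnected in the controller-side event-triggered feedback loop described in the context, where the triggering instants $t_k$ are determined by the condition $\|e_c(t)\|_2^2>\delta\|y_c(t)\|_2^2$ with $\delta\in(0,1]$, and let $w_2=0$. Let $$\beta(\nu_p)=\begin{cases}\rho_c-\nu_p-\delta(1+\nu_p)&\text{if }\nu_p>0,\\ \rho_c-\delta&\text{if }\nu_p=0,\\ \rho_c+2\nu_p-\delta(1-3\nu_p)&\text{if }\nu_p<0.\end{cases}$$ Then the networked control system is passive from $w_1$ to $y_p$ with input passivity index $\epsilon_0$ and output passivity index $\delta_0$, meaning $$\dot V(t)\le w_1^T(t)y_p(t)-\epsilon_0\,w_1^T(t)w_1(t)-\delta_0\,y_p^T(t)y_p(t)$$ for a storage function $V$ of the interconnection, where $$\epsilon_0<\min\Big(\nu_p,\ \nu_p-|\nu_p|-\frac{\nu_p^2}{\beta(\nu_p)}\Big),\qquad 0\le\delta_0\le\rho_p+\nu_c-\frac14.$$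
   Context: Systems: a system $G$ has the form $\dot x=f(x,u)$, $y=h(x,u)$ with state $x\in X\subset\mathbb{R}^n$ and $u(t),y(t)\in\mathbb{R}^m$. A storage function is a nonnegative function $V$ of the state; it is taken differentiable, and $\dot V(t)$ is the time derivative along solutions. $G$ is IF-OFP (input feed-forward output feedback passive) with input passivity index $\nu\in\mathbb{R}$ and output passivity index $\rho\in\mathbb{R}$ (of either sign) if there is a storage function $V$ with $\dot V\le u^Ty-\rho y^Ty-\nu u^Tu$ for all $t$ along all solutions. Controller-side event-triggered loop: $G_p$ (plant, state $x_p$, input $u_p$, output $y_p$) has indices $(\nu_p,\rho_p)$, and $G_c$ (controller, state $x_c$, input $u_c$, output $y_c$) has indices $(\nu_c,\rho_c)$; all inputs and outputs are $\mathbb{R}^m$-valued. External signals $w_1,w_2$ are $\mathbb{R}^m$-valued. At event instants $t_k$ the controller output is sampled and sent to the plant, and is held constant until the next event. For $t\in[t_k,t_{k+1})$: $u_c(t)=w_2(t)+y_p(t)$, $u_p(t)=w_1(t)-y_c(t_k)$, $e_c(t)=y_c(t)-y_c(t_k)$ (so $u_p=w_1+e_c-y_c$). A new event is triggered as soon as $\|e_c(t)\|_2^2>\delta\|y_c(t)\|_2^2$ (Euclidean norm of the vectors at time $t$), so that $e_c^T(t)e_c(t)\le\delta\, y_c^T(t)y_c(t)$ holds at all times. A storage function of the interconnection is a nonnegative function $V$ of $(x_p,x_c)$; inequalities on $\dot V$ are required along all solutions for all $t$ in the intervals $[t_k,t_{k+1})$.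
   Formalization: The hypothesis β(ν_p) > 0 is added: the claim divides by β(ν_p) and is false for negative β, e.g. plant x' = 3x+u, y = x with controller y_c = −u_c, δ = 1/4, indices (0,−3) and (4,−5). *)

(* Defs.v *)
From mathcomp Require Import all_boot all_order all_algebra.
From mathcomp Require Import all_classical all_reals all_analysis.

Set Implicit Arguments.
Unset Strict Implicit.
Unset Printing Implicit Defensive.

Import Order.TTheory GRing.Theory Num.Theory.
Import numFieldNormedType.Exports.

Local Open Scope classical_set_scope.
Local Open Scope ring_scope.

Section Defs.
Context {R : realType}.

(* The norm that MathComp-Analysis puts on 'cV[R]_m is the sup norm, hence the
   explicit Euclidean inner product. *)
Definition dot {m : nat} (u v : 'cV[R]_m) : R := (u^T *m v) 0 0.

Definition sqnorm2 {m : nat} (u : 'cV[R]_m) : R := dot u u.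

(* [a, b[, with possibly infinite endpoints; empty unless a < b *)
Definition co_itv (a b : \bar R) : set R := [set s | (a <= s%:E < b)%E].

(* Derivative at t of a curve known on I only: right derivative at the left
   endpoint of [a, b[ (a switching instant), two-sided inside ]a, b[. *)
Definition is_derive_within {U : normedModType R} (I : set R) (c : R -> U)
    (t : R) (dc : U) : Prop :=
  (s - t)^-1 *: (c s - c t) @[s --> within I t^'] --> dc.

(* x' = f (x, u), y = h (x, u), with state space X, a subset of R^n *)
Record system (n m : nat) := System {
  state : set 'cV[R]_n;
  dyn : 'cV[R]_n -> 'cV[R]_m -> 'cV[R]_n;
  out : 'cV[R]_n -> 'cV[R]_m -> 'cV[R]_m }.

Definition is_solution {n m : nat} (G : system n m) (I : set R)
    (x : R -> 'cV[R]_n) (u y : R -> 'cV[R]_m) : Prop :=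
  forall t, I t ->
    [/\ state G (x t),
        is_derive_within I x t (dyn G (x t) (u t)) &
        y t = out G (x t) (u t)].

Definition is_storage {U : normedModType R} (X : set U) (V : U -> R) : Prop :=
  forall x, X x -> 0 <= V x /\ differentiable V x.

(* dV/dt (t) <= s along the state trajectory x on I *)
Definition dissipation {U : normedModType R} (V : U -> R) (I : set R)
    (x : R -> U) (t s : R) : Prop :=
  exists2 dV : R, is_derive_within I (V \o x : R -> R^o) t dV & dV <= s.

(* Solutions are taken on every interval [a, b[, so that the signals of a
   closed loop between two consecutive events qualify. *)
Definition IF_OFP {n m : nat} (G : system n m) (nu rho : R) : Prop :=
  exists2 V : 'cV[R]_n -> R, is_storage (state G) V &
    forall (a : R) (b : \bar R) x u y,
      is_solution G (co_itv a%:E b) x u y ->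
      forall t, co_itv a%:E b t ->
        dissipation V (co_itv a%:E b) x t
          (dot (u t) (y t) - rho * dot (y t) (y t) - nu * dot (u t) (u t)).

Definition triggers {m : nat} (delta : R) (s y : 'cV[R]_m) : bool :=
  sqnorm2 (y - s) > delta * sqnorm2 y.

(* [tk k, tk (k+1)[, cut at the horizon T of the solution *)
Definition hold_itv (tk : nat -> \bar R) (T : \bar R) (k : nat) : set R :=
  co_itv (tk k) (Order.min (tk k.+1) T).

(* yc (tk k); only relevant when tk k is finite *)
Definition sample {m : nat} (tk : nat -> \bar R) (yc : R -> 'cV[R]_m) (k : nat)
  : 'cV[R]_m := yc (fine (tk k)).

(* A solution on [0, T[ (T may be +oo) of the loop with event-triggered
   sampling of the controller output.  Event times are extended reals:
   tk k = +oo means that fewer than k events occur after time 0. *)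
Record ncs_solution {np nc m : nat} (Gp : system np m) (Gc : system nc m)
    (delta : R) (w1 w2 : R -> 'cV[R]_m) (tk : nat -> \bar R) (T : \bar R)
    (xp : R -> 'cV[R]_np) (up yp : R -> 'cV[R]_m)
    (xc : R -> 'cV[R]_nc) (uc yc : R -> 'cV[R]_m) : Prop := NcsSolution {
  ncs_start : tk 0%N = 0%E;
  ncs_events : forall k,
    (tk k < tk k.+1)%E \/ (tk k = +oo%E /\ tk k.+1 = +oo%E);
  ncs_xp_cont : {within co_itv 0%E T, continuous xp};
  ncs_xc_cont : {within co_itv 0%E T, continuous xc};
  ncs_plant : forall k, is_solution Gp (hold_itv tk T k) xp up yp;
  ncs_controller : forall k, is_solution Gc (hold_itv tk T k) xc uc yc;
  ncs_uc : forall k t, hold_itv tk T k t -> uc t = w2 t + yp t;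
  ncs_up : forall k t, hold_itv tk T k t -> up t = w1 t - sample tk yc k;
  ncs_no_trigger : forall k t, hold_itv tk T k t ->
    ~~ triggers delta (sample tk yc k) (yc t);
  (* No spurious event: at t = tk (k+1), y is the controller output just before
     the sample is updated.  The bound is not strict because, for continuous
     signals, the infimum of the times at which the (strict) trigger condition
     holds is a time of equality. *)
  ncs_trigger : forall k t, tk k.+1 = t%:E -> (t%:E < T)%E ->
    let s := sample tk yc k in
    let y := out Gc (xc t) (w2 t + out Gp (xp t) (w1 t - s)) in
    delta * sqnorm2 y <= sqnorm2 (y - s) }.

(* Passivity from w1 to yp, for w2 = 0, with input index eps0 and output
   index delta0. *)
Definition ncs_passive {np nc m : nat} (Gp : system np m) (Gc : system nc m)
    (delta eps0 delta0 : R) : Prop :=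
  exists2 V : 'cV[R]_np * 'cV[R]_nc -> R,
    is_storage (state Gp `*` state Gc) V &
    forall (w1 : R -> 'cV[R]_m) tk T xp up yp xc uc yc,
      ncs_solution Gp Gc delta w1 (cst 0) tk T xp up yp xc uc yc ->
      forall k t, hold_itv tk T k t ->
        dissipation V (hold_itv tk T k) (fun s => (xp s, xc s)) t
          (dot (w1 t) (yp t) - eps0 * dot (w1 t) (w1 t)
             - delta0 * dot (yp t) (yp t)).

Definition beta (rho_c delta nu_p : R) : R :=
  if 0 < nu_p then rho_c - nu_p - delta * (1 + nu_p)
  else if nu_p == 0 then rho_c - delta
  else rho_c + 2 * nu_p - delta * (1 - 3 * nu_p).

End Defs.

Arguments system R n m : clear implicits.

(* Main.v *)
Require Import Defs.
From mathcomp Require Import all_boot all_order all_algebra.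
From mathcomp Require Import all_classical all_reals all_analysis.
From mathcomp Require Import ring lra.

Import Order.TTheory GRing.Theory Num.Theory.
Import numFieldNormedType.Exports.

Local Open Scope classical_set_scope.
Local Open Scope ring_scope.

(** The sum V (xp, xc) = Vp xp + Vc xc of the two storage functions is a
    storage function of the loop.  Between two events, uc = yp and
    up = w + e - yc, where e is the difference between the controller output yc
    and its held sample; the cross terms yc.yp of the two supply rates cancel,
    so that

      dV/dt <= w.yp + e.yp - (rho_p + nu_c) |yp|^2
               - nu_p |w + e - yc|^2 - rho_c |yc|^2.

    Young's inequality e.yp <= |e|^2 + |yp|^2 / 4 is what costs the 1/4 in the
    output index.  What is left to show is that the quadratic form

      |e|^2 - nu_p |w + e - yc|^2 - rho_c |yc|^2 + eps0 |w|^2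

    is nonpositive as long as no event is triggered, i.e. |e|^2 <= delta |yc|^2
    ([held_output_form_le0]).  After expanding, Young's inequality with equal
    weights removes the products w.e and e.yc, the bound on |e|^2 turns e into
    yc, and the coefficient of |yc|^2 is then at most - beta; the last product
    w.yc is absorbed by Young's inequality with weight beta, which produces the
    term nu_p^2 / beta of the input index. *)

Section EuclideanInnerProduct.
Context {R : realType} {m : nat}.
Implicit Types (u v w : 'cV[R]_m) (a b c : R).

Lemma dotE u v : dot u v = \sum_i u i 0 * v i 0.
Proof. by rewrite /dot mxE; apply: eq_bigr => i _; rewrite mxE. Qed.

Lemma dotC u v : dot u v = dot v u.
Proof. by rewrite !dotE; apply: eq_bigr => i _; rewrite mulrC. Qed.

Lemma dotDl u v w : dot (u + v) w = dot u w + dot v w.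
Proof. by rewrite /dot linearD mulmxDl mxE. Qed.

Lemma dotDr u v w : dot u (v + w) = dot u v + dot u w.
Proof. by rewrite dotC dotDl !(dotC u). Qed.

Lemma dotZl a u v : dot (a *: u) v = a * dot u v.
Proof. by rewrite /dot linearZ /= -scalemxAl mxE. Qed.

Lemma dotZr a u v : dot u (a *: v) = a * dot u v.
Proof. by rewrite dotC dotZl dotC. Qed.

Lemma dotNl u v : dot (- u) v = - dot u v.
Proof. by rewrite -scaleN1r dotZl mulN1r. Qed.

Lemma dotNr u v : dot u (- v) = - dot u v.
Proof. by rewrite dotC dotNl dotC. Qed.

Lemma sqnorm2_ge0 u : 0 <= sqnorm2 u.
Proof.
by rewrite /sqnorm2 dotE; apply: sumr_ge0 => i _; rewrite -expr2 sqr_ge0.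
Qed.

(** This is |b v - c u|^2 / b >= 0, expanded. *)
Lemma dot_Young c b u v : 0 < b ->
  2 * c * dot u v <= c ^+ 2 / b * sqnorm2 u + b * sqnorm2 v.
Proof.
move=> b0; rewrite -subr_ge0.
suff -> : c ^+ 2 / b * sqnorm2 u + b * sqnorm2 v - 2 * c * dot u v
          = sqnorm2 (b *: v - c *: u) / b.
  by rewrite divr_ge0 ?sqnorm2_ge0// ltW.
rewrite /sqnorm2 !(dotDl, dotDr, dotNl, dotNr, dotZl, dotZr) (dotC v u).
by field; rewrite gt_eqF.
Qed.

Lemma ler_dot2 u v : 2 * dot u v <= sqnorm2 u + sqnorm2 v.
Proof. by have := dot_Young 1 1 u v ltr01; rewrite expr1n divr1 mulr1 !mul1r. Qed.

Lemma lerN_dot2 u v : - (2 * dot u v) <= sqnorm2 u + sqnorm2 v.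
Proof.
have := dot_Young (- 1) 1 u v ltr01.
by rewrite sqrrN expr1n divr1 mulrN1 !mul1r mulNr.
Qed.

(** Expanding - nu |w + e - y|^2 and removing the products w.e and e.y by Young's
    inequality leaves, besides a multiple of w.y:
    - for nu > 0, at most nu |e|^2, since the squares of the expansion
      have the favourable sign and pay for the products; this is the factor
      1 + nu of delta in beta;
    - for nu < 0, at most |nu| (2 |w|^2 + 3 |e|^2 + 2 |y|^2), since squares and
      products now add up; these are the coefficients nu - |nu| of the bound on
      eps0, 1 - 3 nu and 2 nu of beta. *)
Lemma held_output_form_le0 (nu rho_c delta eps0 : R) (w e y : 'cV[R]_m) :
  0 < beta rho_c delta nu ->
  eps0 < Num.min nu (nu - `|nu| - nu ^+ 2 / beta rho_c delta nu) ->
  sqnorm2 e <= delta * sqnorm2 y ->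
  sqnorm2 e - nu * sqnorm2 (w + e - y) - rho_c * sqnorm2 y
    + eps0 * sqnorm2 w <= 0.
Proof.
move=> b0; rewrite lt_min => /andP[_ heps] he.
have hwy := dot_Young nu _ w y b0.
have hw : eps0 * sqnorm2 w
    <= (nu - `|nu| - nu ^+ 2 / beta rho_c delta nu) * sqnorm2 w.
  by rewrite ler_wpM2r ?sqnorm2_ge0// ltW.
have expand : sqnorm2 (w + e - y) = sqnorm2 w + sqnorm2 e + sqnorm2 y
    + 2 * dot w e - 2 * dot w y - 2 * dot e y.
  rewrite /sqnorm2 !(dotDl, dotDr, dotNl, dotNr) (dotC e w) (dotC y w).
  by rewrite (dotC y e); ring.
rewrite expand {expand}.
move: b0 hwy hw; set q := nu ^+ 2 / _; rewrite /beta.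
have [nu0|nu0|nu0] := ltgtP 0 nu => /= b0 hwy.
- have hwe := ler_wpM2l (ltW nu0) (lerN_dot2 w e).
  have hey := ler_wpM2l (ltW nu0) (ler_dot2 e y).
  have hy := mulr_ge0 (ltW nu0) (sqnorm2_ge0 y).
  have nu1 : 0 <= 1 + nu by lra.
  have := ler_wpM2l nu1 he.
  by rewrite gtr0_norm//; lra.
- have nu0' : 0 <= - nu by lra.
  have hwe := ler_wpM2l nu0' (ler_dot2 w e).
  have hey := ler_wpM2l nu0' (lerN_dot2 e y).
  have nu1 : 0 <= 1 - 3 * nu by lra.
  have := ler_wpM2l nu1 he.
  by rewrite ltr0_norm//; lra.
- have := mulr_ge0 (ltW b0) (sqnorm2_ge0 y).
  by rewrite /q -nu0 normr0 expr0n mul0r; lra.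
Qed.

End EuclideanInnerProduct.

Section AlongSolutions.
Context {R : realType}.

Lemma is_derive_withinD {U : normedModType R} (I : set R) (f g : R -> U)
    (t : R) (df dg : U) :
  is_derive_within I f t df -> is_derive_within I g t dg ->
  is_derive_within I (f \+ g) t (df + dg).
Proof.
move=> hf hg; rewrite /is_derive_within.
have -> : (fun s => (s - t)^-1 *: ((f \+ g) s - (f \+ g) t)) =
    (fun s => (s - t)^-1 *: (f s - f t))
      \+ (fun s => (s - t)^-1 *: (g s - g t)).
  by apply/funext => s /=; rewrite -scalerDr opprD addrACA.
exact: cvgD.
Qed.

Lemma dissipationD {U1 U2 : normedModType R} (V1 : U1 -> R) (V2 : U2 -> R)
    (I : set R) (x1 : R -> U1) (x2 : R -> U2) (t s1 s2 s : R) :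
  dissipation V1 I x1 t s1 -> dissipation V2 I x2 t s2 -> s1 + s2 <= s ->
  dissipation (fun x => V1 x.1 + V2 x.2) I (fun r => (x1 r, x2 r)) t s.
Proof.
move=> [d1 hd1 le1] [d2 hd2 le2] les; exists (d1 + d2).
  exact: is_derive_withinD hd1 hd2.
exact: le_trans (lerD le1 le2) les.
Qed.

Lemma is_storageD {U1 U2 : normedModType R} (X1 : set U1) (X2 : set U2)
    (V1 : U1 -> R) (V2 : U2 -> R) :
  is_storage X1 V1 -> is_storage X2 V2 ->
  is_storage (X1 `*` X2) (fun x => V1 x.1 + V2 x.2).
Proof.
move=> h1 h2 [x1 x2] [/= /h1[V1_ge0 dV1] /h2[V2_ge0 dV2]].
split; first exact: addr_ge0.
have df : differentiable (fst : U1 * U2 -> U1) (x1, x2).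
  by apply: linear_differentiable => p; exact: cvg_fst.
have dg : differentiable (snd : U1 * U2 -> U2) (x1, x2).
  by apply: linear_differentiable => p; exact: cvg_snd.
exact: (differentiableD (differentiable_comp df _) (differentiable_comp dg _)).
Qed.

(** Event times increase from 0, which excludes -oo, and the point t excludes
    +oo.  Hence the dissipation inequalities of the two subsystems, which hold on
    intervals with a finite left endpoint, apply between two events. *)
Lemma hold_itv_finite_start (tk : nat -> \bar R) (T : \bar R) (k : nat) (t : R) :
  tk 0%N = 0%E ->
  (forall i, (tk i < tk i.+1)%E \/ (tk i = +oo%E /\ tk i.+1 = +oo%E)) ->
  hold_itv tk T k t ->
  exists a, hold_itv tk T k = co_itv a%:E (Order.min (tk k.+1) T).
Proof.
move=> tk0 tkS /andP[tk_le _].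
have tk_ge0 : (0 <= tk k)%E.
  elim: k {tk_le} => [|k IHk]; first by rewrite tk0.
  by case: (tkS k) => [/ltW|[_ ->]]; [exact: le_trans|exact: leey].
exists (fine (tk k)); rewrite /hold_itv fineK//.
by rewrite ge0_fin_numE// (le_lt_trans tk_le) ?ltry.
Qed.

End AlongSolutions.

Theorem theorem9 (R : realType) (np nc m : nat)
    (Gp : system R np m) (Gc : system R nc m)
    (nu_p rho_p nu_c rho_c delta eps0 delta0 : R)
    (hGp : IF_OFP Gp nu_p rho_p) (hGc : IF_OFP Gc nu_c rho_c)
    (hdelta : 0 < delta <= 1)
    (hbeta : 0 < beta rho_c delta nu_p)
    (heps0 : eps0 < Num.min nu_p
       (nu_p - `|nu_p| - nu_p ^+ 2 / beta rho_c delta nu_p))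
    (hdelta0 : 0 <= delta0 <= rho_p + nu_c - 1 / 4) :
  ncs_passive Gp Gc delta eps0 delta0.
Proof.
have [Vp Vp_storage Vp_diss] := hGp; have [Vc Vc_storage Vc_diss] := hGc.
exists (fun x => Vp x.1 + Vc x.2); first exact: is_storageD.
move=> w1 tk T xp up yp xc uc yc sol k t tI.
have [tk0 tkS _ _ /(_ k) plant /(_ k) controller] := sol.
move=> /(_ k t tI) uc_t /(_ k t tI) up_t /(_ k t tI) no_trigger _.
have [a itvE] := hold_itv_finite_start _ _ _ _ tk0 tkS tI.
rewrite itvE in tI plant controller *.
apply: dissipationD (Vp_diss _ _ _ _ _ plant t tI)
  (Vc_diss _ _ _ _ _ controller t tI) _.
set s := sample tk yc k in up_t no_trigger.
set w := w1 t in up_t *; set yP := yp t in uc_t *; set yC := yc t in no_trigger *.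
have e_le : sqnorm2 (yC - s) <= delta * sqnorm2 yC by rewrite leNgt.
have up_e : up t = w + (yC - s) - yC by rewrite up_t addrA addrAC addrK.
rewrite uc_t add0r up_e; move: (yC - s) e_le => e e_le.
have form_le0 := held_output_form_le0 _ _ _ _ w _ _ hbeta heps0 e_le.
(* The weight 1/4 on yp is the one that makes the weight of |e|^2 equal to 1,
   as in the quadratic form above. *)
have young : dot e yP <= sqnorm2 e + 4^-1 * sqnorm2 yP.
  have q0 : 0 < 4^-1 :> R by rewrite invr_gt0.
  by have := dot_Young 2^-1 _ e yP q0; lra.
have yP_le : delta0 * sqnorm2 yP <= (rho_p + nu_c - 1 / 4) * sqnorm2 yP.
  by case/andP: hdelta0 => _; apply: ler_wpM2r; exact: sqnorm2_ge0.
have expand : dot (w + e - yC) yP = dot w yP + dot e yP - dot yP yC.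
  by rewrite !dotDl dotNl (dotC yC).
move: form_le0 young yP_le; rewrite expand /sqnorm2; lra.
Qed.
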